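(* Let $p,q$ be positive integers, let $\Omega\subseteq\mathbb{C}$ be open and let $f:\Omega\to\mathbb{C}$ be sufficiently differentiable (of class $C^{p+q}$ in the real sense). Then on $\Omega$, $$e^{z\overline{z}}\,\partial_{\overline{z}}^{p}\partial_z^{q}\left(e^{-z\overline{z}}f\right)=(-1)^{p+q}\,p!\,q!\sum_{j=0}^{p}\sum_{k=0}^{q}\frac{(-1)^{j+k}}{j!\,k!}\,\frac{H_{p-j,q-k}(z,\overline{z})}{(p-j)!\,(q-k)!}\,\partial_{\overline{z}}^{j}\partial_z^{k}(f).$$
   Context: For $z=x+iy\in\mathbb{C}$, $\partial_z=\frac12\left(\frac{\partial}{\partial x}-i\frac{\partial}{\partial y}\right)$ and $\partial_{\overline{z}}=\frac12\left(\frac{\partial}{\partial x}+i\frac{\partial}{\partial y}\right)$. The complex Hermite polynomials are, for integers $p,q\ge 0$, $$H_{p,q}(z,\overline{z})=(-1)^{p+q}e^{z\overline{z}}\,\partial_{\overline{z}}^{p}\partial_z^{q}\left(e^{-z\overline{z}}\right).$$ *)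

(* Defs.v *)
From Stdlib Require Import Reals Factorial.
From Coquelicot Require Import Coquelicot.
Open Scope C_scope.

Definition Cexp (z : C) : C :=
  (exp (Re z) * cos (Im z), exp (Re z) * sin (Im z))%R.

(* Real partial derivatives of a complex-valued function of z = x + iy, taken
   on its real and imaginary parts.  [Derive] is total: its value is
   meaningful only where [ex_dx], [ex_dy] hold. *)
Definition dx (f : C -> C) (z : C) : C :=
  (Derive (fun t : R => Re (f (t, Im z))) (Re z),
   Derive (fun t : R => Im (f (t, Im z))) (Re z)).

Definition dy (f : C -> C) (z : C) : C :=
  (Derive (fun t : R => Re (f (Re z, t))) (Im z),
   Derive (fun t : R => Im (f (Re z, t))) (Im z)).

Definition ex_dx (f : C -> C) (z : C) : Prop :=
  ex_derive (fun t : R => Re (f (t, Im z))) (Re z) /\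
  ex_derive (fun t : R => Im (f (t, Im z))) (Re z).

Definition ex_dy (f : C -> C) (z : C) : Prop :=
  ex_derive (fun t : R => Re (f (Re z, t))) (Im z) /\
  ex_derive (fun t : R => Im (f (Re z, t))) (Im z).

Definition d_z (f : C -> C) (z : C) : C := / 2 * (dx f z - Ci * dy f z).

Definition d_zbar (f : C -> C) (z : C) : C := / 2 * (dx f z + Ci * dy f z).

(* Real class C^n on the set U (meant to be open): all iterated real partial
   derivatives of order at most n exist and are continuous at each point of U. *)
Fixpoint class_C (n : nat) (U : C -> Prop) (f : C -> C) : Prop :=
  (forall z : C, U z -> continuous f z) /\
  match n with
  | O => True
  | S m => (forall z : C, U z -> ex_dx f z /\ ex_dy f z) /\
           class_C m U (dx f) /\ class_C m U (dy f)
  end.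

Definition hermite (p q : nat) (z : C) : C :=
  (-1) ^ (p + q) * Cexp (z * Cconj z) *
  Nat.iter p d_zbar (Nat.iter q d_z (fun w : C => Cexp (- (w * Cconj w)))) z.

Definition Cfact (n : nat) : C := RtoC (INR (fact n)).

(* Main.v *)
Require Import Defs.
From Corelib Require Import ssreflect.
From Stdlib Require Import Reals Factorial Lia FunctionalExtensionality.
From Coquelicot Require Import Coquelicot.
Open Scope C_scope.

(** The identity is the Leibniz rule, applied first to the derivation [d_z] and
    then to the derivation [d_zbar], for the product of the Gaussian
    [exp (- z zbar)] with [f]: the derivatives of the Gaussian are, up to sign
    and the factor [exp (z zbar)], the Hermite polynomials. *)

(** * Partial derivatives of complex-valued functions *)

Definition is_Cderive (h : R -> C) (t : R) (l : C) : Prop :=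
  is_derive (fun s => Re (h s)) t (Re l) /\
  is_derive (fun s => Im (h s)) t (Im l).

(** A relational form of the partial derivatives: it records existence together with the values,
    whereas [dx] and [dy] are total and say nothing about existence. *)
Definition has_partials (f : C -> C) (z a b : C) : Prop :=
  is_Cderive (fun t => f (t, Im z)) (Re z) a /\
  is_Cderive (fun t => f (Re z, t)) (Im z) b.

Lemma is_Cderive_plus h1 h2 t l1 l2 :
  is_Cderive h1 t l1 -> is_Cderive h2 t l2 ->
  is_Cderive (fun s => h1 s + h2 s) t (l1 + l2).
Proof.
intros [r1 i1] [r2 i2]; split.
- exact (is_derive_plus _ _ _ _ _ r1 r2).
- exact (is_derive_plus _ _ _ _ _ i1 i2).
Qed.

Lemma is_Cderive_mult h1 h2 t l1 l2 :
  is_Cderive h1 t l1 -> is_Cderive h2 t l2 ->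
  is_Cderive (fun s => h1 s * h2 s) t (l1 * h2 t + h1 t * l2).
Proof.
intros [r1 i1] [r2 i2].
assert (M : forall u v a b, is_derive u t a -> is_derive v t b ->
  is_derive (fun s => u s * v s)%R t (a * v t + u t * b)%R).
{ intros u v a b Hu Hv.
  exact (is_derive_mult u v t a b Hu Hv Rmult_comm). }
split.
- pose proof (is_derive_minus _ _ _ _ _ (M _ _ _ _ r1 r2) (M _ _ _ _ i1 i2)) as H.
  replace (Re (l1 * h2 t + h1 t * l2))
    with (minus (Re l1 * Re (h2 t) + Re (h1 t) * Re l2)%R
                (Im l1 * Im (h2 t) + Im (h1 t) * Im l2)%R); [exact H|].
  unfold minus, plus, opp, Re, Im; simpl; ring.
- pose proof (is_derive_plus _ _ _ _ _ (M _ _ _ _ r1 i2) (M _ _ _ _ i1 r2)) as H.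
  replace (Im (l1 * h2 t + h1 t * l2))
    with (plus (Re l1 * Im (h2 t) + Re (h1 t) * Im l2)%R
                (Im l1 * Re (h2 t) + Im (h1 t) * Re l2)%R); [exact H|].
  unfold plus, Re, Im; simpl; ring.
Qed.

Lemma is_Cderive_ext_loc h1 h2 t l :
  locally t (fun s => h1 s = h2 s) -> is_Cderive h1 t l -> is_Cderive h2 t l.
Proof.
intros E [Hr Hi]; split.
- refine (is_derive_ext_loc _ _ _ _ _ Hr).
  apply: filter_imp E => s -> //.
- refine (is_derive_ext_loc _ _ _ _ _ Hi).
  apply: filter_imp E => s -> //.
Qed.

Lemma has_partials_dx f z a b : has_partials f z a b -> dx f z = a.
Proof.
intros [[Hr Hi] _]; unfold dx.
rewrite (is_derive_unique _ _ _ Hr) (is_derive_unique _ _ _ Hi).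
now destruct a.
Qed.

Lemma has_partials_dy f z a b : has_partials f z a b -> dy f z = b.
Proof.
intros [_ [Hr Hi]]; unfold dy.
rewrite (is_derive_unique _ _ _ Hr) (is_derive_unique _ _ _ Hi).
now destruct b.
Qed.

Lemma has_partials_plus f g z a b c d :
  has_partials f z a b -> has_partials g z c d ->
  has_partials (fun w => f w + g w) z (a + c) (b + d).
Proof. intros [] []; split; now apply is_Cderive_plus. Qed.

Lemma has_partials_mult f g z a b c d :
  has_partials f z a b -> has_partials g z c d ->
  has_partials (fun w => f w * g w) z (a * g z + f z * c) (b * g z + f z * d).
Proof.
(* Once [z] is a literal pair, [(Re z, Im z)] is convertible to [z], so the values of [f] and [g] at
   the base point match those in the one-variable product rule. *)
intros [Hx Hy] [Kx Ky]; destruct z as [x y]; split.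
- exact (is_Cderive_mult _ _ _ _ _ Hx Kx).
- exact (is_Cderive_mult _ _ _ _ _ Hy Ky).
Qed.

(** A ball of [C] is a product of two real balls, so near [z] the horizontal and vertical lines
    through [z] stay inside the open set [U], where both functions agree. *)
Lemma has_partials_ext_open (U : C -> Prop) f g z a b :
  open U -> (forall w, U w -> f w = g w) -> U z ->
  has_partials f z a b -> has_partials g z a b.
Proof.
intros HU E Uz [Hx Hy].
destruct (HU z Uz) as [eps Heps].
split.
- refine (is_Cderive_ext_loc _ _ _ _ _ Hx); exists eps; intros t Ht.
  apply E, Heps; split; [exact Ht | apply ball_center].
- refine (is_Cderive_ext_loc _ _ _ _ _ Hy); exists eps; intros t Ht.
  apply E, Heps; split; [apply ball_center | exact Ht].
Qed.

(** * Continuity of complex-valued functions *)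

Lemma continuous_ext_open (U : C -> Prop) (f g : C -> C) z :
  open U -> (forall w, U w -> f w = g w) -> U z ->
  continuous f z -> continuous g z.
Proof.
intros HU E Uz; apply continuous_ext_loc.
apply: filter_imp (HU z Uz) => w Uw; now apply E.
Qed.

Lemma continuous_Re (f : C -> C) z : continuous f z -> continuous (fun w => Re (f w)) z.
Proof.
intros H; apply: (continuous_comp f (fun u : C => fst u)); [exact H | apply continuous_fst].
Qed.

Lemma continuous_Im (f : C -> C) z : continuous f z -> continuous (fun w => Im (f w)) z.
Proof.
intros H; apply: (continuous_comp f (fun u : C => snd u)); [exact H | apply continuous_snd].
Qed.

Lemma continuous_Cpair (u v : C -> R) z :
  continuous u z -> continuous v z -> continuous (fun w => (u w, v w) : C) z.
Proof.
intros Hu Hv P [eps HP].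
pose proof (Hu _ (locally_ball (u z) eps)) as Bu.
pose proof (Hv _ (locally_ball (v z) eps)) as Bv.
unfold filtermap in *.
refine (filter_imp _ _ _ (filter_and _ _ Bu Bv)).
intros w [Hw Kw]; apply HP; split; assumption.
Qed.

Lemma continuous_Cplus (f g : C -> C) z :
  continuous f z -> continuous g z -> continuous (fun w => f w + g w) z.
Proof.
intros Hf Hg; apply continuous_Cpair.
- apply: (continuous_plus (fun w => Re (f w)) (fun w => Re (g w))); now apply continuous_Re.
- apply: (continuous_plus (fun w => Im (f w)) (fun w => Im (g w))); now apply continuous_Im.
Qed.

Lemma continuous_Cmult (f g : C -> C) z :
  continuous f z -> continuous g z -> continuous (fun w => f w * g w) z.
Proof.
intros Hf Hg.
pose proof (continuous_Re _ _ Hf) as fr; pose proof (continuous_Im _ _ Hf) as fi.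
pose proof (continuous_Re _ _ Hg) as gr; pose proof (continuous_Im _ _ Hg) as gi.
apply continuous_Cpair.
- apply: (continuous_minus (fun w => Re (f w) * Re (g w))%R (fun w => Im (f w) * Im (g w))%R);
    apply: continuous_mult; assumption.
- apply: (continuous_plus (fun w => Re (f w) * Im (g w))%R (fun w => Im (f w) * Re (g w))%R);
    apply: continuous_mult; assumption.
Qed.

(** * Functions of class C^n *)

Lemma class_C_continuous n U f z : class_C n U f -> U z -> continuous f z.
Proof. destruct n; intros [H _]; apply H. Qed.

Lemma class_C_partials n U f z :
  class_C (S n) U f -> U z -> has_partials f z (dx f z) (dy f z).
Proof.
intros (_ & H & _) Uz; destruct (H z Uz) as [[] []].
split; split; now apply Derive_correct.
Qed.

Lemma class_C_ext n U f g :
  open U -> (forall z, U z -> f z = g z) -> class_C n U f -> class_C n U g.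
Proof.
intros HU; revert f g; induction n as [|n IH]; intros f g E Hf.
- split; [|exact I]; intros z Uz.
  now apply (continuous_ext_open U f), (class_C_continuous 0 U).
- assert (P : forall z, U z -> has_partials g z (dx f z) (dy f z)).
  { intros z Uz; apply (has_partials_ext_open U f); trivial.
    now apply (class_C_partials n U). }
  destruct (Hf) as (_ & _ & Hx & Hy); split; [|split; [|split]].
  + intros z Uz; now apply (continuous_ext_open U f), (class_C_continuous (S n) U).
  + intros z Uz; destruct (P z Uz) as [[] []]; repeat split; eexists; eassumption.
  + refine (IH _ _ _ Hx); intros z Uz; symmetry; exact (has_partials_dx _ _ _ _ (P z Uz)).
  + refine (IH _ _ _ Hy); intros z Uz; symmetry; exact (has_partials_dy _ _ _ _ (P z Uz)).
Qed.

(** Lets regularity be checked on explicit formulas [a], [b] for the partial derivatives. These need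
    to agree with [dx f] and [dy f] on [U] only, which [class_C_ext] makes sufficient. *)
Lemma class_C_S_intro n U f a b :
  open U -> (forall z, U z -> continuous f z) ->
  (forall z, U z -> has_partials f z (a z) (b z)) ->
  class_C n U a -> class_C n U b -> class_C (S n) U f.
Proof.
intros HU Hc P Ha Hb; split; [exact Hc|split; [|split]].
- intros z Uz; destruct (P z Uz) as [[] []]; repeat split; eexists; eassumption.
- refine (class_C_ext _ _ _ _ HU _ Ha); intros z Uz; symmetry; exact (has_partials_dx _ _ _ _ (P z Uz)).
- refine (class_C_ext _ _ _ _ HU _ Hb); intros z Uz; symmetry; exact (has_partials_dy _ _ _ _ (P z Uz)).
Qed.

Lemma class_C_pred n U f : class_C (S n) U f -> class_C n U f.
Proof.
revert f; induction n as [|n IH]; intros f (Hc & Hd & Hx & Hy).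
- now split.
- split; [exact Hc|]; split; [exact Hd|]; split; now apply IH.
Qed.

Lemma class_C_plus n U f g :
  open U -> class_C n U f -> class_C n U g -> class_C n U (fun w => f w + g w).
Proof.
intros HU; revert f g; induction n as [|n IH]; intros f g Hf Hg.
- split; [|exact I]; intros z Uz.
  apply continuous_Cplus; now apply (class_C_continuous 0 U).
- apply class_C_S_intro with (fun w => dx f w + dx g w) (fun w => dy f w + dy g w); trivial.
  + intros z Uz; apply continuous_Cplus; now apply (class_C_continuous (S n) U).
  + intros z Uz; apply has_partials_plus; now apply (class_C_partials n U).
  + apply IH; [apply Hf | apply Hg].
  + apply IH; [apply Hf | apply Hg].
Qed.

(** The partial derivatives of a product involve [f] and [g] themselves next to their derivatives.
    The induction therefore lowers the class of the undifferentiated factor by [class_C_pred]. *)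
Lemma class_C_mult n U f g :
  open U -> class_C n U f -> class_C n U g -> class_C n U (fun w => f w * g w).
Proof.
intros HU; revert f g; induction n as [|n IH]; intros f g Hf Hg.
- split; [|exact I]; intros z Uz.
  apply continuous_Cmult; now apply (class_C_continuous 0 U).
- apply class_C_S_intro with (fun w => dx f w * g w + f w * dx g w)
                             (fun w => dy f w * g w + f w * dy g w); trivial.
  + intros z Uz; apply continuous_Cmult; now apply (class_C_continuous (S n) U).
  + intros z Uz; apply has_partials_mult; now apply (class_C_partials n U).
  + apply class_C_plus; trivial; apply IH;
      first [apply Hf | apply Hg | now apply class_C_pred].
  + apply class_C_plus; trivial; apply IH;
      first [apply Hf | apply Hg | now apply class_C_pred].
Qed.

Lemma has_partials_const (c z : C) : has_partials (fun _ => c) z 0 0.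
Proof. split; split; exact: is_derive_const. Qed.

Lemma class_C_const n U (c : C) : open U -> class_C n U (fun _ => c).
Proof.
intros HU; revert c; induction n as [|n IH]; intros c.
- split; [|exact I]; intros; apply continuous_const.
- apply class_C_S_intro with (fun _ => 0) (fun _ => 0); trivial.
  + intros; apply continuous_const.
  + intros; apply has_partials_const.
Qed.

Lemma class_C_Re n U : open U -> class_C n U (fun w => RtoC (Re w)).
Proof.
intros HU.
assert (Hc : forall z : C, U z -> continuous (fun w : C => RtoC (Re w)) z).
{ intros z _; apply continuous_Cpair; [apply continuous_Re, continuous_id | apply continuous_const]. }
destruct n as [|n]; [now split|].
apply class_C_S_intro with (fun _ => 1) (fun _ => 0); trivial; try now apply class_C_const.
intros z _; split; split; first [exact: is_derive_const | exact: is_derive_id].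
Qed.

Lemma class_C_Im n U : open U -> class_C n U (fun w => RtoC (Im w)).
Proof.
intros HU.
assert (Hc : forall z : C, U z -> continuous (fun w : C => RtoC (Im w)) z).
{ intros z _; apply continuous_Cpair; [apply continuous_Im, continuous_id | apply continuous_const]. }
destruct n as [|n]; [now split|].
apply class_C_S_intro with (fun _ => 0) (fun _ => 1); trivial; try now apply class_C_const.
intros z _; split; split; first [exact: is_derive_const | exact: is_derive_id].
Qed.

(** * The Gaussian and its smoothness *)

Definition gauss (w : C) : C := Cexp (- (w * Cconj w)).

(** The exponent is real because a number times its conjugate is its squared modulus, so the
    trigonometric factors of [Cexp] are evaluated at 0. *)
Lemma gaussE w : gauss w = RtoC (exp (- (Re w * Re w + Im w * Im w))).
Proof.
destruct w as [x y]; unfold gauss, Cexp, Re, Im, RtoC; simpl.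
replace (- (x * - y + y * x))%R with 0%R by ring.
replace (- (x * x - y * - y))%R with (- (x * x + y * y))%R by ring.
rewrite cos_0 sin_0; f_equal; ring.
Qed.

Lemma gauss_partials z :
  has_partials gauss z (RtoC (-2) * RtoC (Re z) * gauss z)
                       (RtoC (-2) * RtoC (Im z) * gauss z).
Proof.
rewrite gaussE; split.
- apply is_Cderive_ext_loc with
    (fun t => RtoC (exp (- (t * t + Im z * Im z)))).
  { apply filter_forall; intros t; now rewrite gaussE. }
  split; unfold RtoC, Re, Im; simpl; auto_derive; trivial; ring.
- apply is_Cderive_ext_loc with
    (fun t => RtoC (exp (- (Re z * Re z + t * t)))).
  { apply filter_forall; intros t; now rewrite gaussE. }
  split; unfold RtoC, Re, Im; simpl; auto_derive; trivial; ring.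
Qed.

Lemma gauss_continuous z : continuous gauss z.
Proof.
apply continuous_ext with (fun w => RtoC (exp (- (Re w * Re w + Im w * Im w)))).
{ intros w; now rewrite gaussE. }
pose proof (continuous_Re _ z (continuous_id z)) as Hr.
pose proof (continuous_Im _ z (continuous_id z)) as Hi.
apply continuous_Cpair; [|apply continuous_const].
apply: (continuous_comp (fun w => (- (Re w * Re w + Im w * Im w))%R) exp).
- apply: continuous_opp; apply: continuous_plus; apply: continuous_mult; assumption.
- apply: ex_derive_continuous; eexists; apply is_derive_exp.
Qed.

(** The induction closes because each partial derivative is again the Gaussian, multiplied by a
    linear function of one coordinate. *)
Lemma class_C_gauss n U : open U -> class_C n U gauss.
Proof.
intros HU; induction n as [|n IH].
- split; [|exact I]; intros; apply gauss_continuous.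
- apply class_C_S_intro with (fun w => RtoC (-2) * RtoC (Re w) * gauss w)
                             (fun w => RtoC (-2) * RtoC (Im w) * gauss w); trivial.
  + intros; apply gauss_continuous.
  + intros; apply gauss_partials.
  + apply class_C_mult; trivial; apply class_C_mult; trivial;
      [now apply class_C_const | now apply class_C_Re].
  + apply class_C_mult; trivial; apply class_C_mult; trivial;
      [now apply class_C_const | now apply class_C_Im].
Qed.

(** * Wirtinger derivatives and the Leibniz rule *)

(** The parameter [c] covers both operators, [- Ci] for [d_z] and [Ci] for [d_zbar], so the Leibniz
    rule is proved once for all constants. *)
Definition wirtinger (c : C) (f : C -> C) (z : C) : C := / 2 * (dx f z + c * dy f z).

Lemma d_zE : d_z = wirtinger (- Ci).
Proof.
do 2 (apply functional_extensionality; intro); unfold d_z, wirtinger; ring.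
Qed.

Lemma d_zbarE : d_zbar = wirtinger Ci.
Proof. reflexivity. Qed.

Section Wirtinger.

Variables (c : C) (U : C -> Prop).
Hypothesis HU : open U.

Let D := wirtinger c.

Lemma wirtinger_eq f z a b : has_partials f z a b -> D f z = / 2 * (a + c * b).
Proof.
intros H; unfold D, wirtinger.
now rewrite (has_partials_dx _ _ _ _ H) (has_partials_dy _ _ _ _ H).
Qed.

Lemma class_C_wirtinger n f : class_C (S n) U f -> class_C n U (D f).
Proof.
intros (_ & _ & Hx & Hy).
apply class_C_mult; trivial; [now apply class_C_const|].
apply class_C_plus; trivial.
apply class_C_mult; trivial; now apply class_C_const.
Qed.

Lemma class_C_iter_wirtinger m n f :
  class_C (n + m) U f -> class_C n U (Nat.iter m D f).
Proof.
revert n; induction m as [|m IH]; intros n Hf; simpl.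
- now rewrite Nat.add_0_r in Hf.
- apply class_C_wirtinger, IH; now rewrite -Nat.add_succ_comm in Hf.
Qed.

(** The inductions below peel off the innermost derivative: [D f] is then a new function of class
    one lower, to which the induction hypothesis applies. *)
Lemma iter_wirtinger_S n f : Nat.iter (S n) D f = Nat.iter n D (D f).
Proof. apply Nat.iter_succ_r. Qed.

(** Agreement on the open set [U] passes from two functions to their first derivatives, hence to all
    iterates. This permits rewriting under [Nat.iter] with identities valid on [U] only. *)
Lemma iter_wirtinger_ext n f g z :
  class_C n U f -> (forall w, U w -> f w = g w) -> U z ->
  Nat.iter n D f z = Nat.iter n D g z.
Proof.
revert f g; induction n as [|n IH]; intros f g Hf E Uz; [now apply E|].
rewrite !iter_wirtinger_S; apply IH; trivial; [now apply class_C_wirtinger|].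
intros w Uw; unfold D at 1, wirtinger; symmetry.
apply wirtinger_eq, (has_partials_ext_open U f); trivial.
now apply (class_C_partials n U).
Qed.

Lemma iter_wirtinger_plus n f g z :
  class_C n U f -> class_C n U g -> U z ->
  Nat.iter n D (fun w => f w + g w) z = Nat.iter n D f z + Nat.iter n D g z.
Proof.
revert f g; induction n as [|n IH]; intros f g Hf Hg Uz; [reflexivity|].
rewrite !iter_wirtinger_S.
rewrite -IH; trivial; try now apply class_C_wirtinger.
apply iter_wirtinger_ext; trivial.
- now apply class_C_wirtinger, class_C_plus.
- intros w Uw.
  rewrite (wirtinger_eq _ _ _ _ (has_partials_plus _ _ _ _ _ _ _
    (class_C_partials n U f w Hf Uw) (class_C_partials n U g w Hg Uw))).
  unfold D, wirtinger; ring.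
Qed.

Lemma iter_wirtinger_scal n (a : C) f z :
  class_C n U f -> U z ->
  Nat.iter n D (fun w => a * f w) z = a * Nat.iter n D f z.
Proof.
revert f; induction n as [|n IH]; intros f Hf Uz; [reflexivity|].
rewrite !iter_wirtinger_S -IH; trivial; try now apply class_C_wirtinger.
apply iter_wirtinger_ext; trivial.
- apply class_C_wirtinger, class_C_mult; trivial; now apply class_C_const.
- intros w Uw.
  rewrite (wirtinger_eq _ _ _ _ (has_partials_mult _ _ _ _ _ _ _
    (has_partials_const a w) (class_C_partials n U f w Hf Uw))).
  unfold D, wirtinger; ring.
Qed.

Lemma class_C_sum_n n m (F : nat -> C -> C) :
  (forall k, (k <= m)%nat -> class_C n U (F k)) ->
  class_C n U (fun w => sum_n (fun k => F k w) m).
Proof.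
induction m as [|m IH]; intros HF.
- apply (class_C_ext n U (F 0%nat)); trivial; [|apply HF; lia].
  intros w _; now rewrite sum_O.
- apply (class_C_ext n U (fun w => sum_n (fun k => F k w) m + F (S m) w)); trivial.
  + intros w _; now rewrite sum_Sn.
  + apply class_C_plus; trivial; [|apply HF; lia].
    apply IH; intros; apply HF; lia.
Qed.

Lemma iter_wirtinger_sum_n n m (F : nat -> C -> C) z :
  (forall k, (k <= m)%nat -> class_C n U (F k)) -> U z ->
  Nat.iter n D (fun w => sum_n (fun k => F k w) m) z
  = sum_n (fun k => Nat.iter n D (F k) z) m.
Proof.
intros HF Uz; induction m as [|m IH].
- rewrite sum_O; symmetry; apply iter_wirtinger_ext; trivial; [apply HF; lia|].
  intros w _; now rewrite sum_O.
- assert (HFm : forall k, (k <= m)%nat -> class_C n U (F k)) by (intros; apply HF; lia).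
  rewrite sum_Sn -IH; trivial.
  transitivity (Nat.iter n D (fun w => sum_n (fun k => F k w) m + F (S m) w) z).
  + apply iter_wirtinger_ext; trivial; [now apply class_C_sum_n, HF|].
    intros w _; now rewrite sum_Sn.
  + apply iter_wirtinger_plus; trivial; [now apply class_C_sum_n | now apply HF].
Qed.

End Wirtinger.

(** * Binomial coefficients and Pascal's rule *)

Lemma Cfact_neq_0 n : Cfact n <> 0.
Proof. intros H; apply (INR_fact_neq_0 n); now injection H. Qed.

Lemma Cfact_S n : Cfact (S n) = RtoC (INR (S n)) * Cfact n.
Proof.
unfold Cfact; rewrite -RtoC_mult -mult_INR; reflexivity.
Qed.

(** The factorial form is the one in which coefficients appear in the final formula. It is the
    binomial coefficient for [k <= n]; beyond that the subtraction truncates. *)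
Definition Cbinom (n k : nat) : C := Cfact n / (Cfact k * Cfact (n - k)).

Lemma Cbinom_0 n : Cbinom n 0 = 1.
Proof.
unfold Cbinom; rewrite Nat.sub_0_r; change (Cfact 0) with (RtoC 1).
field; apply Cfact_neq_0.
Qed.

Lemma Cbinom_diag n : Cbinom n n = 1.
Proof.
unfold Cbinom; rewrite Nat.sub_diag; change (Cfact 0) with (RtoC 1).
field; apply Cfact_neq_0.
Qed.

(** Over a common denominator the claim reduces to the identity n + 1 = (k + 1) + (n - k). Writing n
    - k as a successor, possible since k < n, exposes the factors to cancel. *)
Lemma Cbinom_pascal n k : (k < n)%nat ->
  Cbinom (S n) (S k) = Cbinom n (S k) + Cbinom n k.
Proof.
intros Hk; unfold Cbinom.
replace (S n - S k)%nat with (S (n - S k)) by lia.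
replace (n - k)%nat with (S (n - S k)) by lia.
rewrite !Cfact_S.
assert (HS : forall m, RtoC (INR (S m)) <> 0).
{ intros m H; apply (not_0_INR (S m)); [lia | now injection H]. }
assert (HN : RtoC (INR (S n)) = RtoC (INR (S k)) + RtoC (INR (S (n - S k)))).
{ rewrite -RtoC_plus -plus_INR; do 2 f_equal; lia. }
rewrite HN; field; repeat split; first [apply Cfact_neq_0 | apply HS].
Qed.

Lemma sum_n_Cmult_l (a : C) (u : nat -> C) n :
  sum_n (fun k => a * u k) n = a * sum_n u n.
Proof. exact (sum_n_mult_l (K := C_Ring) a u n). Qed.

(** The summation side of the Leibniz induction: [u] and [v] are the terms in which the extra
    derivative falls on the first or the second factor, and [v] enters shifted by one index. *)
Lemma sum_n_pascal (u v w : nat -> C) n :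
  w 0%nat = u 0%nat -> w (S n) = v n ->
  (forall k, (k < n)%nat -> w (S k) = u (S k) + v k) ->
  sum_n w (S n) = sum_n u n + sum_n v n.
Proof.
intros H0 Hn Hk.
(* Because of the shift, the partial sum of [w] up to [m] has absorbed [v] only up to [m - 1]; the
   missing [v m] is added to make the induction go through. *)
assert (H : forall m, (m <= n)%nat -> sum_n w m + v m = sum_n u m + sum_n v m).
{ induction m as [|m IH]; intros Hm.
  - now rewrite !sum_O H0.
  - rewrite !sum_Sn (Hk m) //.
    change plus with Cplus.
    transitivity (sum_n w m + v m + u (S m) + v (S m)); [ring|].
    rewrite IH; [ring | lia]. }
rewrite sum_Sn Hn; now apply H.
Qed.

(** Induction on [n]: the innermost derivative turns the product into [D f * g + f * D g], the
    induction hypothesis expands each summand, and Pascal's rule merges the two expansions. *)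
Lemma iter_wirtinger_leibniz (c : C) (U : C -> Prop) n f g z :
  open U -> class_C n U f -> class_C n U g -> U z ->
  Nat.iter n (wirtinger c) (fun w => f w * g w) z
  = sum_n (fun k => Cbinom n k * (Nat.iter (n - k) (wirtinger c) f z *
                                  Nat.iter k (wirtinger c) g z)) n.
Proof.
intros HU; revert f g; induction n as [|n IH]; intros f g Hf Hg Uz.
- rewrite sum_O Cbinom_0 /=; ring.
- set (D := wirtinger c) in *.
  assert (HDf : class_C n U (D f)) by now apply class_C_wirtinger.
  assert (HDg : class_C n U (D g)) by now apply class_C_wirtinger.
  assert (Hf' := class_C_pred _ _ _ Hf); assert (Hg' := class_C_pred _ _ _ Hg).
  transitivity (Nat.iter n D (fun w => D f w * g w + f w * D g w) z).
  { rewrite Nat.iter_succ_r; apply (iter_wirtinger_ext c U); trivial.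
    - now apply class_C_wirtinger, class_C_mult.
    - intros w Uw; unfold D; rewrite (wirtinger_eq _ _ _ _ _ (has_partials_mult _ _ _ _ _ _ _
        (class_C_partials n U f w Hf Uw) (class_C_partials n U g w Hg Uw))).
      unfold wirtinger; ring. }
  rewrite (iter_wirtinger_plus c U); trivial; try now apply class_C_mult.
  rewrite !IH //; symmetry; apply sum_n_pascal.
  + rewrite !Cbinom_0 !Nat.sub_0_r Nat.iter_succ_r //.
  + rewrite !Cbinom_diag !Nat.sub_diag (Nat.iter_succ_r n) //.
  + intros k Hk; rewrite Cbinom_pascal //.
    (* Both orders are written as successors of [n - S k], so that all three terms carry the same
       iterates of [f] and [g]. *)
    replace (n - k)%nat with (S (n - S k)) by lia.
    replace (S n - S k)%nat with (S (n - S k)) by lia.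
    rewrite -!Nat.iter_succ_r; ring.
Qed.

(** * The double Leibniz expansion and its Hermite coefficients *)

Theorem proposition2p3 (p q : nat) (hp : (0 < p)%nat) (hq : (0 < q)%nat)
  (Omega : C -> Prop) (hOmega : open Omega)
  (f : C -> C) (hf : class_C (p + q) Omega f)
  (z : C) (hz : Omega z) :
  Cexp (z * Cconj z) *
    Nat.iter p d_zbar
      (Nat.iter q d_z (fun w : C => Cexp (- (w * Cconj w)) * f w)) z
  = (-1) ^ (p + q) * Cfact p * Cfact q *
    sum_n (fun j : nat =>
      sum_n (fun k : nat =>
        (-1) ^ (j + k) / (Cfact j * Cfact k) *
        (hermite (p - j) (q - k) z / (Cfact (p - j) * Cfact (q - k))) *
        Nat.iter j d_zbar (Nat.iter k d_z f) z) q) p.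
Proof.
unfold hermite.
change (fun w : C => Cexp (- (w * Cconj w)) * f w) with (fun w : C => gauss w * f w).
change (fun w : C => Cexp (- (w * Cconj w))) with gauss.
rewrite d_zE d_zbarE.
set (dz := wirtinger (- Ci)); set (db := wirtinger Ci).
assert (Hg : forall n k, class_C n Omega (Nat.iter k dz gauss)).
{ intros n k; apply class_C_iter_wirtinger, class_C_gauss; trivial. }
assert (Hmon : forall m n h, class_C (n + m) Omega h -> class_C n Omega h).
{ induction m as [|m IH]; intros n h Hh; [now rewrite Nat.add_0_r in Hh|].
  apply IH, class_C_pred; now rewrite -Nat.add_succ_r. }
(* Of the p + q available derivatives, [dz] consumes k <= q, which leaves at least the p needed for
   [db]. *)
assert (Hf : forall k, (k <= q)%nat -> class_C p Omega (Nat.iter k dz f)).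
{ intros k Hk; apply class_C_iter_wirtinger, (Hmon (q - k)%nat); trivial.
  now replace (p + k + (q - k))%nat with (p + q)%nat by lia. }
assert (Hgf : class_C (p + q) Omega (fun w => gauss w * f w))
  by (apply class_C_mult, hf; trivial; now apply class_C_gauss).
(* The expansion of the [dz] derivatives holds at points of [Omega] only, so it is substituted under
   the iterated [db] through agreement on an open set. *)
rewrite (iter_wirtinger_ext Ci Omega hOmega p _ (fun w => sum_n (fun k => Cbinom q k *
   (Nat.iter (q - k) dz gauss w * Nat.iter k dz f w)) q)); trivial;
  [| now apply class_C_iter_wirtinger
   | intros w Uw; apply (iter_wirtinger_leibniz (- Ci) Omega); trivial;
     [now apply class_C_gauss | apply (Hmon p); now rewrite Nat.add_comm]].
assert (Hprod : forall k, (k <= q)%nat -> class_C p Omega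
  (fun w => Nat.iter (q - k) dz gauss w * Nat.iter k dz f w))
  by (intros k Hk; apply class_C_mult; trivial; now apply Hf).
rewrite (iter_wirtinger_sum_n Ci Omega hOmega); trivial;
  [| intros k Hk; apply class_C_mult; trivial; [now apply class_C_const | now apply Hprod]].
(* The target sums over [j] outermost. The exchange puts [k] outermost, as in the expansion obtained
   by applying [dz] first, and the sums can be compared term by term. *)
rewrite sum_n_switch -!sum_n_Cmult_l.
apply sum_n_ext_loc; intros k Hk.
rewrite (iter_wirtinger_scal Ci Omega); trivial; [|now apply Hprod].
rewrite (iter_wirtinger_leibniz Ci Omega); trivial; [|now apply Hf].
rewrite -!sum_n_Cmult_l.
apply sum_n_ext_loc; intros j Hj.
(* The last sign is the one inside [hermite (p - j) (q - k)]. As j <= p and k <= q, the exponents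
   add up to 2(p + q). *)
assert (Hsign : (-1) ^ (p + q) * (-1) ^ (j + k) * (-1) ^ (p - j + (q - k)) = 1).
{ rewrite -!Cpow_add_r.
  replace (p + q + (j + k) + (p - j + (q - k)))%nat with (2 * (p + q))%nat by lia.
  rewrite Cpow_mult_r; replace ((-1) ^ 2) with (RtoC 1) by (simpl; ring).
  apply Cpow_1_l. }
fold dz db.
set (A := Nat.iter (p - j) db _ z); set (B := Nat.iter j db _ z).
set (E := Cexp _).
(* The sums leave the equation typed in an algebraic structure over [C]; it is restated in [C]
   itself so that the field tactics recognise it. *)
lazymatch goal with |- ?a = ?b => change (@eq C a b) end.
unfold Cbinom.
(* The left side is multiplied by the sign product, equal to 1, so that both sides have the same
   sign factors and only the factorials have to be rearranged. *)
transitivity ((-1) ^ (p + q) * (-1) ^ (j + k) * (-1) ^ (p - j + (q - k)) *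
  (E * (Cfact q / (Cfact k * Cfact (q - k)) *
   (Cfact p / (Cfact j * Cfact (p - j)) * (A * B))))).
{ rewrite Hsign; ring. }
field; repeat split; apply Cfact_neq_0.
Qed.
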